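(* Let $X$ be a reflexive smooth Banach space over $\mathbb{C}$ and let $T\in B(X)$ be a self-adjoint operator such that $T-c(T)I$ is strongly normal. Then $c(T^{2n})=c(T)^{2n}$ for all $n\in\mathbb{N}$.
   Context: $B(X)$ is the space of bounded linear operators on $X$, $S_X=\{x\in X:\|x\|=1\}$, $X^*$ is the space of bounded linear functionals on $X$. $\mathbb{N}$ is the set of natural numbers $\{1,2,3,\dots\}$. $X$ is smooth if every $x\in S_X$ admits a unique $x^*\in S_{X^*}$ with $x^*(x)=1$. The duality mapping $J:X\to X^*$ of a smooth Banach space assigns to each $x$ the unique functional $J(x)$ with $\|J(x)\|=\|x\|$ and $J(x)(x)=\|x\|^2$. For $T\in B(X)$ the transpose $T':X^*\to X^*$ is $(T'f)(x)=f(Tx)$. $T\in B(X)$ is self-adjoint if $T'\circ J=J\circ T$; $T$ is strongly normal if $T=S^2$ for some self-adjoint $S\in B(X)$. The numerical range is $W(T)=\{x^*(Tx):x\in S_X,\ x^*\in S_{X^*},\ x^*(x)=1\}$ (so $W(T)=\{J(x)(Tx):x\in S_X\}$), and the Crawford number is $c(T)=\inf\{|\lambda|:\lambda\in W(T)\}$. *)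

(* Defs.v *)
From HB Require Import structures.
From mathcomp Require Import all_boot all_order all_algebra.
From mathcomp Require Import all_classical all_reals all_analysis.
From mathcomp Require Import complex.

Set Implicit Arguments.
Unset Strict Implicit.
Unset Printing Implicit Defensive.

Import Order.TTheory GRing.Theory Num.Theory.
Import numFieldNormedType.Exports.

Local Open Scope classical_set_scope.
Local Open Scope complex_scope.
Local Open Scope ring_scope.

(* Norms of a [normedModType R[i]] take values in R[i] (they are nonnegative
   reals there); [complex.Re] brings them back to R whenever a supremum or an
   infimum is needed. *)

Section BoundedOperators.
Context {R : realType}.
Implicit Types X Y : normedModType R[i].

Definition bounded_linear X Y : {pred X -> Y} := fun f =>
  `[< linear f /\ exists M : R[i], forall x, `|f x| <= M * `|x| >].

Record bounded_op X Y := BoundedOp {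
  bounded_op_fun :> X -> Y ;
  _ : bounded_op_fun \in @bounded_linear X Y }.

HB.instance Definition _ X Y := [isSub for @bounded_op_fun X Y].
HB.instance Definition _ X Y := gen_eqMixin (bounded_op X Y).
HB.instance Definition _ X Y := gen_choiceMixin (bounded_op X Y).

Lemma bounded_opP X Y (f : bounded_op X Y) :
  linear f /\ exists M : R[i], forall x, `|f x| <= M * `|x|.
Proof. exact/asboolP/(valP f). Qed.

Lemma bounded_op_linear X Y (f : bounded_op X Y) : linear f.
Proof. by have [] := bounded_opP f. Qed.

HB.instance Definition _ X Y (f : bounded_op X Y) :=
  GRing.isLinear.Build R[i] X Y *:%R (bounded_op_fun f) (bounded_op_linear f).

Lemma bounded_op_ext X Y (f g : bounded_op X Y) : f =1 g -> f = g.
Proof. by move=> fg; apply: val_inj; apply/funext. Qed.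

Lemma bounded_linear_submod_closed X Y : submod_closed (@bounded_linear X Y).
Proof.
split=> [|a f g /asboolP[lf [M Mf]] /asboolP[lg [N Ng]]]; apply/asboolP; split.
- by move=> k x y; rewrite /= scaler0 addr0.
- by exists 0 => x; rewrite normr0 mul0r.
- by move=> k x y; rewrite !fctE lf lg !scalerDr !scalerA (mulrC a) addrACA.
- exists (`|a| * M + N) => x; rewrite !fctE (le_trans (ler_normD _ _))//.
  by rewrite mulrDl -mulrA normrZ lerD// ler_wpM2l.
Qed.

HB.instance Definition _ X Y := GRing.isSubmodClosed.Build R[i] (X -> Y)
  (@bounded_linear X Y) (@bounded_linear_submod_closed X Y).
HB.instance Definition _ X Y := [SubChoice_isSubLmodule of bounded_op X Y by <:].

Definition op_norm X Y (f : bounded_op X Y) : R[i] :=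
  (sup [set complex.Re `|f x| | x in [set x : X | `|x| <= 1]])%:C.

Lemma Re_normK X (x : X) : (complex.Re `|x|)%:C = `|x|.
Proof. exact/RRe_real/ger0_real/normr_ge0. Qed.

Lemma op_norm_has_sup X Y (f : bounded_op X Y) :
  has_sup [set complex.Re `|f x| | x in [set x : X | `|x| <= 1]].
Proof.
split; first by exists (complex.Re `|f 0|), 0 => //=; rewrite normr0.
have [_ [M Mf]] := bounded_opP f; exists (complex.Re `|M|) => _ [x x1 <-].
rewrite -lecR Re_normK (RRe_real (normr_real M)) (le_trans (Mf x))//.
have := le_trans (normr_ge0 _) (Mf x).
have [->|x0] := eqVneq x 0; first by rewrite normr0 mulr0.
rewrite pmulr_lge0 ?normr_gt0// => M0.
by rewrite (ger0_norm M0) ler_piMr.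
Qed.

Lemma op_norm_ub X Y (f : bounded_op X Y) x : `|x| <= 1 -> `|f x| <= op_norm f.
Proof.
move=> x1; rewrite -Re_normK lecR.
by apply: (ub_le_sup (op_norm_has_sup f).2); exists x.
Qed.

Lemma op_norm_le X Y (f : bounded_op X Y) (M : R[i]) : M \is Num.real ->
  (forall x, `|x| <= 1 -> `|f x| <= M) -> op_norm f <= M.
Proof.
move=> Mr Mf; rewrite -(RRe_real Mr) lecR.
apply: ge_sup; first exact: (op_norm_has_sup f).1.
by move=> _ [x /= x1 <-]; rewrite -lecR Re_normK (RRe_real Mr) Mf.
Qed.

Lemma op_norm_ge0 X Y (f : bounded_op X Y) : 0 <= op_norm f.
Proof.
by apply: le_trans (normr_ge0 (f 0)) (op_norm_ub _ _); rewrite normr0.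
Qed.

Lemma le_op_norm X Y (f : bounded_op X Y) x : `|f x| <= op_norm f * `|x|.
Proof.
have [->|x0] := eqVneq x 0; first by rewrite linear0 !normr0 mulr0.
have nx0 : 0 < `|x| by rewrite normr_gt0.
rewrite -ler_pdivrMr// mulrC.
have -> : `|x|^-1 * `|f x| = `|f (`|x|^-1 *: x)|.
  by rewrite linearZ normrZ normfV normr_id.
by apply: op_norm_ub; rewrite normrZ normfV normr_id mulVf// gt_eqF.
Qed.

Lemma op_normD X Y (f g : bounded_op X Y) :
  op_norm (f + g) <= op_norm f + op_norm g.
Proof.
apply: op_norm_le => [|x x1]; first by rewrite ger0_real// addr_ge0 ?op_norm_ge0.
by rewrite (le_trans (ler_normD _ _))// lerD ?op_norm_ub.
Qed.

Lemma op_normZ X Y (a : R[i]) (f : bounded_op X Y) :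
  op_norm (a *: f) = `|a| * op_norm f.
Proof.
have le_ b (g : bounded_op X Y) : op_norm (b *: g) <= `|b| * op_norm g.
  apply: op_norm_le => [|x x1]; first by rewrite ger0_real// mulr_ge0 ?op_norm_ge0.
  by rewrite normrZ ler_wpM2l ?op_norm_ub.
apply/eqP; rewrite eq_le le_ /=.
have [->|a0] := eqVneq a 0; first by rewrite normr0 mul0r op_norm_ge0.
rewrite -ler_pdivlMl ?normr_gt0// -normfV.
by have := le_ a^-1 (a *: f); rewrite scalerA mulVf// scale1r.
Qed.

Lemma op_norm0_eq0 X Y (f : bounded_op X Y) : op_norm f = 0 -> f = 0.
Proof.
move=> f0; apply: bounded_op_ext => x; apply/normr0_eq0/eqP.
by rewrite eq_le normr_ge0 andbT (le_trans (le_op_norm f x))// f0 mul0r.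
Qed.

HB.instance Definition _ X Y := Lmodule_isNormed.Build R[i] (bounded_op X Y)
  (@op_normD X Y) (@op_normZ X Y) (@op_norm0_eq0 X Y).

Lemma id_bounded_linear X : idfun \in @bounded_linear X X.
Proof. by apply/asboolP; split=> //; exists 1 => x; rewrite mul1r. Qed.

Definition id_op X : bounded_op X X := BoundedOp (id_bounded_linear X).

Lemma comp_bounded_linear X Y (Z : normedModType R[i])
  (f : bounded_op Y Z) (g : bounded_op X Y) : f \o g \in @bounded_linear X Z.
Proof.
apply/asboolP; split=> [a x y|]; first by rewrite /= !linearP.
exists (op_norm f * op_norm g) => x; rewrite (le_trans (le_op_norm _ _))//.
by rewrite -mulrA ler_wpM2l ?op_norm_ge0// le_op_norm.
Qed.

Definition comp_op X Y (Z : normedModType R[i])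
    (f : bounded_op Y Z) (g : bounded_op X Y) : bounded_op X Z :=
  BoundedOp (comp_bounded_linear f g).

Section OperatorRing.
Variable X : normedModType R[i].

Let comp_opA : associative (@comp_op X X X).
Proof. by move=> f g h; exact: bounded_op_ext. Qed.
Let comp_1op : left_id (id_op X) (@comp_op X X X).
Proof. by move=> f; exact: bounded_op_ext. Qed.
Let comp_op1 : right_id (id_op X) (@comp_op X X X).
Proof. by move=> f; exact: bounded_op_ext. Qed.
Let comp_opDl : left_distributive (@comp_op X X X) +%R.
Proof. by move=> f g h; exact: bounded_op_ext. Qed.
Let comp_opDr : right_distributive (@comp_op X X X) +%R.
Proof. by move=> f g h; apply: bounded_op_ext => x /=; exact: linearD. Qed.

(* The product of B(X) is composition, so that [1] is the identity operator and
   [T ^+ n] the n-th iterate of T.  The ring is a [pzRingType] because it is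
   trivial when X is. *)
HB.instance Definition _ := GRing.Zmodule_isPzRing.Build (bounded_op X X)
  comp_opA comp_1op comp_op1 comp_opDl comp_opDr.

End OperatorRing.

End BoundedOperators.

Section NumericalRange.
Context {R : realType}.
Implicit Types X : normedModType R[i].

Definition dual X : normedModType R[i] := bounded_op X R[i]^o.

(* Surjectivity of the canonical embedding of X into its bidual. *)
Definition reflexive_space X :=
  forall F : dual (dual X), exists x : X, forall f : dual X, F f = f x.

Definition smooth X :=
  forall x : X, `|x| = 1 -> exists! f : dual X, `|f| = 1 /\ f x = 1.

(* When X is smooth the set below is a singleton for every x; the default
   value 0 of [xget] is relevant only outside the smooth case. *)
Definition duality_map X (x : X) : dual X :=
  xget 0 [set f : dual X | `|f| = `|x| /\ f x = `|x| ^+ 2].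

Definition transpose X (T : bounded_op X X) (f : dual X) : dual X :=
  comp_op f T.

Definition self_adjoint X (T : bounded_op X X) :=
  transpose T \o @duality_map X = @duality_map X \o T.

Definition strongly_normal X (T : bounded_op X X) :=
  exists2 S : bounded_op X X, self_adjoint S & T = S ^+ 2.

Definition numerical_range X (T : bounded_op X X) : set R[i] :=
  [set l | exists (x : X) (f : dual X),
    [/\ `|x| = 1, `|f| = 1, f x = 1 & l = f (T x)]].

(* For X = {0} the numerical range is empty and, [inf set0] being 0, so is the
   Crawford number. *)
Definition crawford X (T : bounded_op X X) : R :=
  inf [set complex.Re `|l| | l in numerical_range T].

End NumericalRange.

(* Main.v *)
Require Import Defs.
From HB Require Import structures.
From mathcomp Require Import all_boot all_order all_algebra.
From mathcomp Require Import all_classical all_reals all_analysis.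
From mathcomp Require Import complex.
Import Order.TTheory GRing.Theory Num.Theory.
Import numFieldNormedType.Exports.
Local Open Scope complex_scope.
Local Open Scope ring_scope.

(** Write [J] for the duality map.  Self-adjointness reads
    [J x (S y) = J (S x) y], whence [J x (S (S x)) = `|S x| ^+ 2].  Applied to
    [S := T ^+ n], this identifies the numerical range of [T ^+ (2 * n)] with
    the set of all [`|T ^+ n x| ^+ 2], [x] a unit vector, and the claim becomes
    that the infimum of [`|T ^+ n x|] over unit vectors is [c ^+ n], where
    [c := crawford T].

    Lower bound: [c <= `|J x (T x)| <= `|T x|] on unit vectors
    ([crawford_le_norm]), so each application of [T] stretches norms by at
    least [c].

    Upper bound: let [T - c = S ^+ 2] with [S] self-adjoint.  On unit vectors
    [J x (T x) = c + `|S x| ^+ 2] ([numerical_value_shifted_square]), so unit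
    vectors whose numerical value almost attains [c] are almost killed by [S],
    hence by [T - c = S ^+ 2]: they are approximate eigenvectors of [T] for the
    eigenvalue [c] ([crawford_approx_eigenvector]).  They are then approximate
    eigenvectors of [T ^+ n] for [c ^+ n] ([approx_eigenvector_exp]), and
    [`|T ^+ n x|] comes arbitrarily close to [c ^+ n]. *)

Lemma Re_norm_ge0 {R : realType} {V : normedModType R[i]} (v : V) :
  0 <= complex.Re `|v|.
Proof. by rewrite -lecR Re_normK; exact: normr_ge0. Qed.

Section DualityMap.
Context {R : realType} {X : normedModType R[i]}.
Context (X_smooth : smooth X).
Implicit Types (x y : X) (f : dual X) (S : bounded_op X X) (n : nat).

(** Smoothness provides norming functionals at unit vectors only; the other
    nonzero vectors are reached by scaling. *)
Lemma duality_mapP x :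
  `|duality_map x| = `|x| /\ duality_map x x = `|x| ^+ 2.
Proof.
rewrite /duality_map; case: xgetP => [f _ //|none]; exfalso.
have [x0|x0] := eqVneq x 0.
  by apply: (none 0); rewrite /= x0 !normr0 expr0n.
have nx0 : `|x| != 0 by rewrite normr_eq0.
have [|f [[f1 fx1] _]] := X_smooth (`|x|^-1 *: x).
  by rewrite normrZ normfV normr_id mulVf.
apply: (none (`|x| *: f)); split; first by rewrite normrZ f1 mulr1 normr_id.
suff fx : f x = `|x| by rewrite -[LHS]/(`|x| * f x) fx.
have : f (`|x| *: (`|x|^-1 *: x)) = `|x|.
  by rewrite linearZ/= fx1 /GRing.scale/= mulr1.
by rewrite scalerA mulfV// scale1r.
Qed.

Lemma duality_map_uniq x f :
  `|x| = 1 -> `|f| = 1 -> f x = 1 -> f = duality_map x.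
Proof.
move=> x1 f1 fx1; have [g [_ g_uniq]] := X_smooth x x1.
have [Jx1 Jxx] := duality_mapP x.
rewrite -(g_uniq f)// -(g_uniq (duality_map x))//.
by rewrite Jxx Jx1 x1 expr1n.
Qed.

Lemma self_adjoint_duality S x y :
  self_adjoint S -> duality_map x (S y) = duality_map (S x) y.
Proof.
move=> adjS.
by have /(congr1 (fun f : dual X => f y)) := congr1 (@^~ x) adjS.
Qed.

Lemma self_adjoint_exp S n : self_adjoint S -> self_adjoint (S ^+ n).
Proof.
move=> adjS; elim: n => [|n IHn].
  by apply/funext => x; exact: bounded_op_ext.
apply/funext => x; apply: bounded_op_ext => y.
have -> : (S ^+ n.+1 : bounded_op X X) = comp_op S (S ^+ n) by rewrite exprS.
rewrite /= -self_adjoint_duality// -self_adjoint_duality//.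
have -> // : S ((S ^+ n : bounded_op X X) y) = (S ^+ n : bounded_op X X) (S y).
by rewrite -[LHS]/((S * S ^+ n : bounded_op X X) y) -exprS exprSr.
Qed.

Lemma self_adjoint_square S x :
  self_adjoint S -> duality_map x (S (S x)) = `|S x| ^+ 2.
Proof. by move=> adjS; rewrite self_adjoint_duality// (duality_mapP _).2. Qed.

Lemma numerical_rangeP S l :
  numerical_range S l <-> exists2 x, `|x| = 1 & l = duality_map x (S x).
Proof.
split=> [[x [f [x1 f1 fx1 ->]]]|[x x1 ->]].
  by exists x => //; rewrite -(duality_map_uniq x f).
exists x, (duality_map x); have [Jx1 Jxx] := duality_mapP x.
by rewrite Jxx Jx1 x1 expr1n.
Qed.

Lemma crawford_lb S x : `|x| = 1 -> (crawford S)%:C <= `|duality_map x (S x)|.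
Proof.
move=> x1; rewrite -(Re_normK (duality_map x (S x) : R[i]^o)) lecR.
apply: ge_inf; last first.
  by exists (duality_map x (S x)) => //; apply/numerical_rangeP; exists x.
by exists 0 => _ [l _ <-]; exact: (Re_norm_ge0 (l : R[i]^o)).
Qed.

Lemma crawford_glb S (a : R) : (exists x : X, `|x| = 1) ->
  (forall x, `|x| = 1 -> a%:C <= `|duality_map x (S x)|) -> a <= crawford S.
Proof.
move=> [x x1] aS; apply: lb_le_inf => [|_ [_ /numerical_rangeP[y y1 ->] <-]].
  exists (complex.Re `|duality_map x (S x)|), (duality_map x (S x)) => //.
  by apply/numerical_rangeP; exists x.
by rewrite -lecR (Re_normK (duality_map y (S y) : R[i]^o)) aS.
Qed.

Lemma crawford_ge0 S : 0 <= crawford S.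
Proof.
rewrite /crawford; set A := (A in inf A).
have [->|A0] := eqVneq A set0; first by rewrite inf0.
apply: lb_le_inf; first exact/set0P.
by move=> _ [l _ <-]; exact: (Re_norm_ge0 (l : R[i]^o)).
Qed.

Lemma crawford_trivial S : ~ (exists x : X, `|x| = 1) -> crawford S = 0.
Proof.
move=> no_unit; rewrite /crawford.
suff -> : numerical_range S = set0 by rewrite image_set0 inf0.
by apply/seteqP; split=> // l [x [f [x1 _ _ _]]]; apply: no_unit; exists x.
Qed.

(** A unit vector [x] has [`|J x| = 1], so its numerical value is at most
    [`|S x|]; the general case follows by scaling. *)
Lemma crawford_le_norm S x : (crawford S)%:C * `|x| <= `|S x|.
Proof.
have [->|x0] := eqVneq x 0; first by rewrite linear0 !normr0 mulr0.
have nx0 : 0 < `|x| by rewrite normr_gt0.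
have u1 : `|(`|x|^-1 *: x)| = 1.
  by rewrite normrZ normfV normr_id mulVf// gt_eqF.
have := crawford_lb S _ u1.
have := le_op_norm (duality_map (`|x|^-1 *: x)) (S (`|x|^-1 *: x)).
have -> : op_norm (duality_map (`|x|^-1 *: x)) = 1.
  by rewrite -[LHS]/(`|duality_map (`|x|^-1 *: x)|) (duality_mapP _).1.
rewrite mul1r => /[swap] /le_trans /[apply].
by rewrite linearZ/= normrZ normfV normr_id mulrC ler_pdivlMr.
Qed.

Lemma crawford_exp_le_norm S n x :
  (crawford S)%:C ^+ n * `|x| <= `|(S ^+ n : bounded_op X X) x|.
Proof.
have c0 : 0 <= (crawford S)%:C by rewrite lecR crawford_ge0.
elim: n => [|n IHn]; first by rewrite expr0 mul1r.
rewrite !exprS -mulrA (le_trans (ler_wpM2l c0 IHn))//.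
exact: crawford_le_norm.
Qed.

(** [S ^+ n - c ^+ n] is a polynomial in [S] times [S - c]; the constant is
    built along [S ^+ n.+1 - c ^+ n.+1 = S ^+ n (S - c) + c (S ^+ n - c ^+ n)]. *)
Lemma approx_eigenvector_exp S (c : R[i]) n :
  exists2 M : R[i], 0 <= M &
    forall x, `|(S ^+ n : bounded_op X X) x - c ^+ n *: x| <= M * `|S x - c *: x|.
Proof.
elim: n => [|n [M M0 IHn]].
  by exists 0 => // x; rewrite expr0 scale1r subrr normr0 mul0r.
exists (op_norm (S ^+ n) + `|c| * M) => [|x].
  by rewrite addr_ge0 ?mulr_ge0 ?op_norm_ge0.
have -> : (S ^+ n.+1 : bounded_op X X) x - c ^+ n.+1 *: x =
    (S ^+ n : bounded_op X X) (S x - c *: x)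
      + c *: ((S ^+ n : bounded_op X X) x - c ^+ n *: x).
  rewrite exprSr [in RHS]linearB [in RHS]linearZ/=.
  by rewrite scalerBr scalerA -exprS addrA subrK.
rewrite (le_trans (ler_normD _ _))// mulrDl lerD ?le_op_norm//.
by rewrite normrZ -mulrA ler_wpM2l.
Qed.

Lemma numerical_value_shifted_square S T (c : R[i]) x :
  self_adjoint S -> T - c *: id_op X = S ^+ 2 -> `|x| = 1 ->
  duality_map x (T x) = c + `|S x| ^+ 2.
Proof.
move=> adjS TS x1; rewrite -self_adjoint_square//.
have -> : S (S x) = T x - c *: x.
  by rewrite -[LHS]/((S ^+ 2 : bounded_op X X) x) -TS.
rewrite linearB linearZ/= (duality_mapP x).2 x1 expr1n.
by rewrite /GRing.scale/= mulr1 addrC subrK.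
Qed.

(** Since [J x (T x) = c + `|S x| ^+ 2], a numerical value within [d ^+ 2] of
    its infimum [c] forces [`|S x| < d], and [T x - c x = S (S x)]. *)
Lemma crawford_approx_eigenvector T : (exists x : X, `|x| = 1) ->
  strongly_normal (T - (crawford T)%:C *: id_op X) ->
  exists2 M : R[i], 0 <= M & forall d : R, 0 < d ->
    exists2 x, `|x| = 1 & `|T x - (crawford T)%:C *: x| <= M * d%:C.
Proof.
move=> unitX [S adjS TS]; exists (op_norm S) => [|d d0]; first exact: op_norm_ge0.
have [x x1 Sxd] : exists2 x, `|x| = 1 & `|S x| <= d%:C.
  apply: contrapT => far.
  suff : crawford T + d ^+ 2 <= crawford T.
    by apply/negP; rewrite -ltNge ltrDl exprn_gt0.
  apply: crawford_glb => // x x1.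
  rewrite (numerical_value_shifted_square S T _ x adjS TS x1).
  rewrite ger0_norm; last by rewrite addr_ge0 ?exprn_ge0// lecR crawford_ge0.
  rewrite rmorphD rmorphXn lerD2l -Re_normK -!rmorphXn lecR.
  rewrite ler_sqr ?nnegrE ?Re_norm_ge0 ?(ltW d0)//.
  rewrite leNgt; apply/negP => Sxd; apply: far; exists x => //.
  by rewrite -Re_normK lecR ltW.
exists x => //.
have -> : T x - (crawford T)%:C *: x = S (S x).
  by rewrite -[RHS]/((S ^+ 2 : bounded_op X X) x) -TS.
by rewrite (le_trans (le_op_norm _ _))// ler_wpM2l// op_norm_ge0.
Qed.

Lemma norm_numerical_value_double_exp T n x : self_adjoint T ->
  `|duality_map x ((T ^+ (2 * n) : bounded_op X X) x)| =
  `|(T ^+ n : bounded_op X X) x| ^+ 2.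
Proof.
move=> /(self_adjoint_exp T n) adjTn; rewrite mul2n -addnn exprD.
set Tn : bounded_op X X := T ^+ n in adjTn *.
rewrite -[(Tn * Tn : bounded_op X X) x]/(Tn (Tn x)).
by rewrite self_adjoint_square// normrX normr_id.
Qed.

End DualityMap.

Theorem corollary4 (R : realType) (X : completeNormedModType R[i])
    (X_reflexive : reflexive_space X) (X_smooth : smooth X)
    (T : bounded_op X X) (T_adj : self_adjoint T)
    (T_normal : strongly_normal (T - (crawford T)%:C *: id_op X)) :
  forall n : nat, (0 < n)%N -> crawford (T ^+ (2 * n)) = crawford T ^+ (2 * n).
Proof.
move=> n n0; have c0 := crawford_ge0 T.
have [unitX|no_unit] := pselect (exists x : X, `|x| = 1); last first.
  by rewrite !crawford_trivial// expr0n muln_eq0 (gtn_eqF n0).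
apply/eqP; rewrite eq_le; apply/andP; split; last first.
  apply: crawford_glb => // x x1; rewrite norm_numerical_value_double_exp//.
  rewrite mulnC exprM !rmorphXn lerXn2r ?nnegrE//.
    by rewrite exprn_ge0 ?lecR.
  by have := crawford_exp_le_norm X_smooth T n x; rewrite x1 mulr1.
have [M M0 Mapprox] := crawford_approx_eigenvector X_smooth T unitX T_normal.
have [N N0 Nexp] := approx_eigenvector_exp T (crawford T)%:C n.
have Kreal : ((complex.Re (N * M))%:C = N * M).
  by apply/RRe_real/ger0_real; rewrite mulr_ge0.
have K0 : 0 <= complex.Re (N * M) by rewrite -lecR Kreal mulr_ge0.
set s := Num.sqrt (crawford (T ^+ (2 * n))).
(* Taking square roots replaces the bounds [(crawford T ^+ n + e) ^+ 2], for
   arbitrary [e > 0], by bounds affine in [e]. *)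
suff s_le : s <= crawford T ^+ n.
  rewrite -[leLHS]sqr_sqrtr ?crawford_ge0// -/s mulnC exprM lerXn2r ?nnegrE//.
    exact: sqrtr_ge0.
  exact: exprn_ge0.
apply/ler_addgt0Pr => e e0.
have K1 : 0 < complex.Re (N * M) + 1 by rewrite ltr_wpDl.
have d0 : 0 < e / (complex.Re (N * M) + 1) by rewrite divr_gt0.
have [x x1 xd] := Mapprox _ d0.
have Tnx : `|(T ^+ n : bounded_op X X) x| <= (crawford T ^+ n + e)%:C.
  rewrite -[X in `|X|](subrK ((crawford T)%:C ^+ n *: x)).
  rewrite (le_trans (ler_normD _ _))// addrC rmorphD rmorphXn lerD//.
    by rewrite normrZ x1 mulr1 ger0_norm// exprn_ge0// lecR.
  rewrite (le_trans (Nexp x))// (le_trans (ler_wpM2l N0 xd))// mulrA -Kreal.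
  rewrite -rmorphM lecR mulrCA ler_piMr ?(ltW e0)//.
  by rewrite ler_pdivrMr// mul1r lerDl.
have ce0 : 0 <= crawford T ^+ n + e by rewrite addr_ge0 ?exprn_ge0// ltW.
rewrite -(ger0_norm ce0) -sqrtr_sqr ler_wsqrtr// -lecR.
rewrite (le_trans (crawford_lb X_smooth _ _ x1))//.
rewrite norm_numerical_value_double_exp// rmorphXn lerXn2r ?nnegrE//.
by rewrite lecR.
Qed.
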